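(* Let $T:D(T)\subset \ell^2(\mathbb{Z}_{\ge 0})\to \ell^2(\mathbb{Z}_{\ge 0})$ be a tridiagonal operator with coefficients $\{l_n\}_{n\ge 0},\{d_n\}_{n\ge 0},\{u_n\}_{n\ge 0}$. For all integers $m,d\ge 0$ we have $$\langle e_d,T^me_0\rangle=l_0l_1\cdots l_{d-1}\,\mu_{m,d},$$ where $\mu_{m,d}$ is the coefficient of $x^d$ in the degree $m$ inverse polynomial of the system of monic polynomials $\{p_n(x)\}_{n\ge 0}$ given by $$p_0(x)=1,\quad p_1(x)=x-b_0,\quad p_{n+1}(x)=(x-b_n)p_n(x)-\lambda_np_{n-1}(x)\ \ (n\ge 1),$$ with $b_n=d_n$ and $\lambda_n=l_{n-1}u_{n-1}$.
   Context: $\ell^2(\mathbb{Z}_{\ge 0})$ is the complex Hilbert space with orthonormal basis $e_0,e_1,e_2,\ldots$. A tridiagonal operator is a linear operator $T:D(T)\subset \ell^2(\mathbb{Z}_{\ge 0})\to\ell^2(\mathbb{Z}_{\ge 0})$, defined on at least the linear span of $\{e_0,e_1,\ldots\}$, for which there are real numbers $\{l_n\}_{n\ge 0},\{d_n\}_{n\ge 0},\{u_n\}_{n\ge 0}$ with $Te_0=d_0e_0+l_0e_1$ and $Te_n=u_{n-1}e_{n-1}+d_ne_n+l_ne_{n+1}$ for $n\ge 1$. The inverse polynomials $q_n(x)=\sum_{i=0}^n q_{n,i}x^i$ of a system of monic polynomials $\{p_n(x)\}_{n\ge 0}$ with $\deg p_n=n$ are defined by $x^n=\sum_{i=0}^n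 q_{n,i}p_i(x)$ for $n\ge 0$. An empty product equals $1$. *)

(* Defs.v *)
From HB Require Import structures.
From mathcomp Require Import all_boot all_order all_algebra complex.
From mathcomp Require Import all_classical all_reals all_analysis.
From mathcomp Require Import ring.

Set Implicit Arguments.
Unset Strict Implicit.
Unset Printing Implicit Defensive.

Import Order.TTheory GRing.Theory Num.Theory.
Import numFieldNormedType.Exports.

Local Open Scope classical_set_scope.
Local Open Scope ring_scope.
Local Open Scope complex_scope.

(* Sequences take values in R[i]^o because the library puts the topology given
   by the modulus on this regular module and none on R[i]. *)

Section ell2.
Context {R : realType}.

Definition sqnormc (z : R[i]) : R := (complex.Re z) ^+ 2 + (complex.Im z) ^+ 2.

Definition square_summable : {pred nat -> R[i]^o} :=
  fun x => `[< cvgn (series (fun n => sqnormc (x n))) >].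

Lemma sqnormc_ge0 z : 0 <= sqnormc z.
Proof. by rewrite addr_ge0 ?sqr_ge0. Qed.

Lemma sqnormcZD (a z w : R[i]) :
  sqnormc (a * z + w) <= 2 * (sqnormc a * sqnormc z + sqnormc w).
Proof.
case: a z w => [a1 a2] [z1 z2] [w1 w2]; rewrite /sqnormc /=.
set s := a1 * z1 - a2 * z2; set t := a1 * z2 + a2 * z1.
have -> : (a1 ^+ 2 + a2 ^+ 2) * (z1 ^+ 2 + z2 ^+ 2) = s ^+ 2 + t ^+ 2.
  by rewrite /s /t; ring.
rewrite -subr_ge0.
have -> : 2 * (s ^+ 2 + t ^+ 2 + (w1 ^+ 2 + w2 ^+ 2))
    - ((s + w1) ^+ 2 + (t + w2) ^+ 2) = (s - w1) ^+ 2 + (t - w2) ^+ 2 by ring.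
by rewrite addr_ge0 ?sqr_ge0.
Qed.

Lemma square_summable_submod_closed : submod_closed square_summable.
Proof.
split=> [|a x y /asboolP xs /asboolP ys]; apply/asboolP.
  rewrite (_ : series _ = cst 0); first exact: is_cvg_cst.
  apply/funext => n; rewrite /series/= big1// => i _.
  by rewrite /sqnormc/= expr0n addr0.
pose v n := 2 * (sqnormc a * sqnormc (x n) + sqnormc (y n)).
apply: (@series_le_cvg _ _ v).
- by move=> n; exact: sqnormc_ge0.
- by move=> n; rewrite mulr_ge0// addr_ge0 ?mulr_ge0 ?sqnormc_ge0.
- by move=> n; exact: sqnormcZD.
- have cxy := is_cvg_seriesD (@is_cvg_seriesZ _ _ (sqnormc a) xs) ys.
  exact: (@is_cvg_seriesZ _ _ 2 cxy).
Qed.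

HB.instance Definition _ :=
  GRing.isSubmodClosed.Build _ _ square_summable square_summable_submod_closed.

End ell2.

Record ell2 (R : realType) := Ell2 {
  ell2_val :> nat -> R[i]^o;
  _ : ell2_val \in square_summable }.
Arguments Ell2 {R} _ _.

HB.instance Definition _ (R : realType) := [isSub for @ell2_val R].
HB.instance Definition _ (R : realType) := [Choice of ell2 R by <:].
HB.instance Definition _ (R : realType) :=
  [SubChoice_isSubLmodule of ell2 R by <:].

Section operators.
Context {R : realType}.

(* Antilinear in the first argument. *)
Definition inner (x y : ell2 R) : R[i] :=
  limn (series (fun n => (x n)^* * y n : R[i]^o)).

Definition unit_seq (k : nat) : nat -> R[i]^o := fun n => (n == k)%:R.

Lemma unit_seq_square_summable k : unit_seq k \in square_summable.
Proof.
apply/asboolP; rewrite -(is_cvg_series_restrict k.+1).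
rewrite (_ : [sequence _]_n = cst 0); first exact: is_cvg_cst.
apply/funext => n /=; rewrite big_nat_cond big1// => i /andP[/andP[ki _] _].
by rewrite /sqnormc /unit_seq gtn_eqF//= expr0n addr0.
Qed.

Definition ebasis (k : nat) : ell2 R := Ell2 _ (unit_seq_square_summable k).

Definition basis_span : {pred ell2 R} := fun x =>
  `[< exists n (a : 'I_n -> R[i]), x = \sum_(i < n) a i *: ebasis i >].

(* The values of opfun outside dom are irrelevant. *)
Record linear_operator := LinearOperator {
  dom : {pred ell2 R};
  opfun :> ell2 R -> ell2 R;
  dom_submod_closed : submod_closed dom;
  opfun_linear : forall (a : R[i]) (x y : ell2 R), x \in dom -> y \in dom ->
    opfun (a *: x + y) = a *: opfun x + opfun y }.

Lemma op_id_dom : submod_closed (predT : {pred ell2 R}).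
Proof. by []. Qed.

Definition op_id : linear_operator :=
  @LinearOperator predT idfun op_id_dom (fun _ _ _ _ _ => erefl).

Definition comp_dom (S T : linear_operator) : {pred ell2 R} :=
  [pred x | (x \in dom T) && (T x \in dom S)].

Lemma opfun0 (T : linear_operator) : T 0 = 0.
Proof.
have [d0 _] := dom_submod_closed T.
have := @opfun_linear T 1 0 0 d0 d0.
by rewrite !scale1r addr0 => /(congr1 (fun z => z - T 0)); rewrite subrr addrK.
Qed.

Lemma comp_dom_submod_closed S T : submod_closed (comp_dom S T).
Proof.
have [S0 Sl] := dom_submod_closed S; have [T0 Tl] := dom_submod_closed T.
split=> [|a x y]; first by rewrite inE T0 opfun0.
rewrite !inE => /andP[xT xS] /andP[yT yS].
by rewrite Tl//= opfun_linear// Sl.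
Qed.

Lemma comp_linear S T (a : R[i]) (x y : ell2 R) :
  x \in comp_dom S T -> y \in comp_dom S T ->
  S (T (a *: x + y)) = a *: S (T x) + S (T y).
Proof.
by rewrite !inE => /andP[xT xS] /andP[yT yS]; rewrite !opfun_linear.
Qed.

Definition op_comp S T : linear_operator :=
  @LinearOperator (comp_dom S T) (fun x => S (T x))
    (comp_dom_submod_closed S T) (@comp_linear S T).

Definition op_pow T m : linear_operator := iter m (op_comp T) op_id.

Definition tridiagonal (T : linear_operator) (l d u : nat -> R) : Prop :=
  [/\ {subset basis_span <= dom T},
      T (ebasis 0) = (d 0)%:C *: ebasis 0 + (l 0)%:C *: ebasis 1 &
      forall n, (1 <= n)%N -> T (ebasis n) =
        (u n.-1)%:C *: ebasis n.-1 + (d n)%:C *: ebasis n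
        + (l n)%:C *: ebasis n.+1].

End operators.
Arguments linear_operator : clear implicits.

Section polynomials.
Context {R : realType}.

Definition is_inverse_poly (p : nat -> {poly R}) (n : nat) (q : {poly R}) :=
  (size q <= n.+1)%N /\ 'X^n = \sum_(i < n.+1) q`_i *: p i.

(* The default value 0 is not used for a monic system with deg p_n = n: see
   inverse_polyP and inverse_poly_uniq. *)
Definition inverse_poly (p : nat -> {poly R}) (n : nat) : {poly R} :=
  xget 0 [set q | is_inverse_poly p n q].

Definition monic_system (p : nat -> {poly R}) :=
  forall n, p n \is monic /\ size (p n) = n.+1.

Lemma monic_system_decomp p : monic_system p ->
  forall n (f : {poly R}), (size f <= n)%N ->
  exists c : nat -> R, f = \sum_(i < n) c i *: p i.
Proof.
move=> mp; elim=> [|n IH] f sf.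
  by exists (fun=> 0); rewrite big_ord0; apply/size_poly_leq0P.
have [/monicP pn1 spn] := mp n.
have [|c cE] := IH (f - f`_n *: p n).
  apply/leq_sizeP => j; rewrite leq_eqVlt => /predU1P[<-|nj].
    rewrite coefB coefZ; move: pn1; rewrite /lead_coef spn /= => ->.
    by rewrite mulr1 subrr.
  rewrite coefB coefZ (nth_default _ (leq_trans sf nj)) [(p n)`_j]nth_default ?spn//.
  by rewrite mulr0 subrr.
exists (fun i => if i == n then f`_n else c i).
rewrite big_ord_recr/= eqxx -[LHS](subrK (f`_n *: p n)) cE; congr (_ + _).
by apply: eq_bigr => i _; rewrite ltn_eqF.
Qed.

Lemma monic_system_free p : monic_system p ->
  forall n (c : nat -> R), \sum_(i < n) c i *: p i = 0 ->
  forall i, (i < n)%N -> c i = 0.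
Proof.
move=> mp; elim=> // n IH c s0.
have cn : c n = 0.
  have := congr1 (fun f : {poly R} => f`_n) s0.
  rewrite coef0 big_ord_recr/= coefD coef_sum big1 ?add0r => [|i _].
    have [/monicP + spn] := mp n.
    by rewrite /lead_coef spn coefZ /= => ->; rewrite mulr1.
  by have [_ spi] := mp i; rewrite coefZ nth_default ?mulr0 ?spi.
move=> i; rewrite ltnS leq_eqVlt => /predU1P[->//|]; apply: IH.
by move: s0; rewrite big_ord_recr/= cn scale0r addr0.
Qed.

Lemma inverse_polyP p n : monic_system p ->
  is_inverse_poly p n (inverse_poly p n).
Proof.
move=> mp; apply: (@xgetPex _ 0 [set q | is_inverse_poly p n q]).
have [|c cE] := @monic_system_decomp p mp n.+1 'X^n; first by rewrite size_polyXn.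
exists (\poly_(i < n.+1) c i); split; first exact: size_poly.
by rewrite cE; apply: eq_bigr => i _; rewrite coef_poly ltn_ord.
Qed.

Lemma inverse_poly_uniq p n q : monic_system p ->
  is_inverse_poly p n q -> inverse_poly p n = q.
Proof.
move=> mp [sq qE]; have [sr rE] := inverse_polyP n mp.
apply/polyP => i; have [ni|ni] := ltnP i n.+1; last first.
  by rewrite !nth_default// (leq_trans _ ni).
apply/eqP; rewrite -subr_eq0; apply/eqP.
apply: (monic_system_free mp (c := fun i => (inverse_poly p n)`_i - q`_i) _ ni).
under eq_bigr do rewrite scalerBl.
by rewrite sumrB -qE -rE subrr.
Qed.

Fixpoint recurrence_poly (b lambda : nat -> R) (n : nat) : {poly R} :=
  match n with
  | 0 => 1
  | n'.+1 =>
    match n' with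
    | 0 => 'X - (b 0%N)%:P
    | n''.+1 => ('X - (b n')%:P) * recurrence_poly b lambda n'
                - lambda n' *: recurrence_poly b lambda n''
    end
  end.

Lemma recurrence_poly_monic b lambda : monic_system (recurrence_poly b lambda).
Proof.
move=> n; suff [] : (recurrence_poly b lambda n \is monic
    /\ size (recurrence_poly b lambda n) = n.+1)
  /\ (recurrence_poly b lambda n.+1 \is monic
    /\ size (recurrence_poly b lambda n.+1) = n.+2) by [].
elim: n => [|n [[m0 s0] [m1 s1]]].
  by split; split; rewrite /= ?monic1 ?size_poly1 ?monicXsubC ?size_XsubC.
split=> //.
set P := ('X - (b n.+1)%:P) * recurrence_poly b lambda n.+1.
set Q := lambda n.+1 *: recurrence_poly b lambda n.
rewrite -[recurrence_poly b lambda n.+2]/(P - Q).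
have mP : P \is monic by rewrite monicMl ?monicXsubC.
have sP : size P = n.+3.
  by rewrite size_monicM ?monicXsubC ?monic_neq0// size_XsubC s1.
have sQ : (size (- Q) < size P)%N.
  by rewrite size_polyN sP (leq_ltn_trans (size_scale_leq _ _))// s0.
by rewrite size_polyDl// monicE lead_coefDl// -monicE.
Qed.

End polynomials.

(* Main.v *)
Require Import Defs.
From mathcomp Require Import all_boot all_order all_algebra complex.
From mathcomp Require Import all_classical all_reals all_analysis.
Import GRing.Theory Num.Theory.
Local Open Scope ring_scope.
Local Open Scope complex_scope.

(** The identity behind the theorem is [p_n(T) e_0 = l_0 ... l_(n-1) e_n]: the
    three-term recurrence of the [p_n] is the one that the vectors
    [l_0 ... l_(n-1) e_n] obey when [T] plays the role of multiplication by
    [x] ([orbit_eval_recurrence_poly]).  Evaluating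
    [x^m = \sum_i mu_(m,i) p_i(x)] at [T] and applying the result to [e_0] gives
    [T^m e_0 = \sum_i mu_(m,i) l_0 ... l_(i-1) e_i], and pairing with [e_k]
    reads off the coefficient of [e_k].

    As [T] may be unbounded, evaluation at [T] is only used on [e_0].  It is
    well behaved there because the linear span of the basis lies in the domain
    of [T] and is mapped into itself by [T]. *)

Section orbit.
Context {R : realType}.
Implicit Types (T : linear_operator R) (f g : {poly R}) (x : ell2 R).

Lemma opfun_sum T n (a : nat -> R[i]) (y : nat -> ell2 R) :
  (forall i, y i \in dom T) ->
  \sum_(i < n) a i *: y i \in dom T /\
  T (\sum_(i < n) a i *: y i) = \sum_(i < n) a i *: T (y i).
Proof.
move=> yT; have [T0 Tl] := dom_submod_closed T.
elim: n => [|n [sT sE]]; first by rewrite !big_ord0 opfun0.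
rewrite !big_ord_recr/= ![_ + a n *: _]addrC.
by split; [exact: Tl|rewrite opfun_linear// sE].
Qed.

Lemma basis_span_submod_closed : submod_closed (@basis_span R).
Proof.
(* Padding with zero coefficients brings two combinations to a common length. *)
have wide n (a : 'I_n -> R[i]) : exists b : nat -> R[i], forall N, (n <= N)%N ->
    \sum_(i < n) a i *: ebasis i = \sum_(i < N) b i *: ebasis i.
  exists (fun i => oapp a 0 (insub i)) => N nN.
  transitivity (\sum_(i < n) oapp a 0 (insub (i : nat)) *: ebasis i : ell2 R).
    by apply: eq_bigr => i _; rewrite valK.
  rewrite (big_ord_widen N (fun i => oapp a 0 (insub i) *: ebasis i : ell2 R))//.
  rewrite big_mkcond/=; apply: eq_bigr => i _; case: ifPn => // ni.
  by rewrite insubN//= scale0r.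
split=> [|a x y /asboolP[n [b ->]] /asboolP[n' [b' ->]]]; apply/asboolP.
  by exists 0%N, (fun=> 0); rewrite big_ord0.
have [c cE] := wide _ b; have [c' cE'] := wide _ b'.
exists (n + n')%N, (fun i => a * c i + c' i).
rewrite (cE (n + n')%N) ?leq_addr// (cE' (n + n')%N) ?leq_addl//.
rewrite scaler_sumr -big_split/=.
by apply: eq_bigr => i _; rewrite scalerA scalerDl.
Qed.

Lemma ebasis_span k : ebasis k \in @basis_span R.
Proof.
apply/asboolP; exists k.+1, (fun i => (i == k :> nat)%:R).
rewrite big_ord_recr/= eqxx scale1r big1 ?add0r// => i _.
by rewrite ltn_eqF// scale0r.
Qed.

Lemma ell2_coord_sum n (a : nat -> R[i]) k :
  (\sum_(i < n) a i *: ebasis i : ell2 R) k = if (k < n)%N then a k else 0.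
Proof.
elim: n => [|n IH]; first by rewrite big_ord0.
rewrite big_ord_recr/=.
rewrite -[LHS]/((\sum_(i < n) a i *: ebasis i : ell2 R) k
                + a n * (k == n)%:R) IH ltnS.
case: ltngtP => [kn|nk|->]; rewrite ?mulr0 ?mulr1 ?add0r ?addr0//.
Qed.

Lemma inner_ebasis k x : inner (ebasis k) x = x k.
Proof.
rewrite /inner; apply: (@cvg_lim _ (@norm_hausdorff R[i] R[i]^o)).
apply: cvg_near_cst; exists k.+1 => // n /= kn.
rewrite /series/= (bigD1_seq k) ?mem_index_iota ?iota_uniq//=.
rewrite /unit_seq eqxx conjC1 mul1r big1 ?addr0// => i /negPf ->.
by rewrite conjC0 mul0r.
Qed.

Context {T : linear_operator R} {l d u : nat -> R}
  (triT : tridiagonal T l d u).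

Lemma tridiagonal_span x : x \in basis_span -> T x \in basis_span.
Proof.
have [sT T0 Tn] := triT; have [s0 sl] := basis_span_submod_closed.
have sZ (a : R[i]) k : a *: ebasis k \in @basis_span R.
  by rewrite -[_ *: _]addr0 sl// ebasis_span.
have sD y z : y \in @basis_span R -> z \in @basis_span R -> y + z \in basis_span.
  by move=> ys zs; rewrite -[y]scale1r sl.
have Te k : T (ebasis k) \in basis_span.
  by case: k => [|k]; rewrite ?T0 ?Tn// !sD.
move=> /asboolP[n [a ->]].
elim: n a => [|n IH] a; first by rewrite big_ord0 opfun0.
rewrite big_ord_recr/= addrC opfun_linear ?sl ?sT ?ebasis_span//.
by apply/asboolP; eexists; eexists.
Qed.

Lemma op_pow_span m :
  ebasis 0 \in dom (op_pow T m) /\ op_pow T m (ebasis 0) \in basis_span.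
Proof.
have [sT _ _] := triT.
elim: m => [|m [IHd IHs]]; first by split=> //; exact: ebasis_span.
by split; [rewrite inE IHd sT|exact: tridiagonal_span].
Qed.

(** The vector [f(T) e_0], for a polynomial [f] with real coefficients.  The
    values [T^j e_0] are meaningful by [op_pow_span] when [T] is tridiagonal. *)
Definition orbit_eval f : ell2 R :=
  \sum_(j < size f) (f`_j)%:C *: op_pow T j (ebasis 0).

Lemma orbit_eval_widen n f : (size f <= n)%N ->
  orbit_eval f = \sum_(j < n) (f`_j)%:C *: op_pow T j (ebasis 0).
Proof.
move=> fn; rewrite /orbit_eval (big_ord_widen n
  (fun j => (f`_j)%:C *: op_pow T j (ebasis 0)))// big_mkcond/=.
apply: eq_bigr => j _; case: ltnP => // fj.
by rewrite nth_default// scale0r.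
Qed.

Lemma orbit_eval_linear (a : R) f g :
  orbit_eval (a *: f + g) = a%:C *: orbit_eval f + orbit_eval g.
Proof.
pose n := maxn (size f) (size g).
have fn : (size f <= n)%N by exact: leq_maxl.
have gn : (size g <= n)%N by exact: leq_maxr.
have afgn : (size (a *: f + g)%R <= n)%N.
  rewrite (leq_trans (size_polyD _ _))// geq_max gn andbT.
  exact: leq_trans (size_scale_leq _ _) fn.
rewrite !(@orbit_eval_widen n)// scaler_sumr -big_split/=.
by apply: eq_bigr => j _; rewrite coefD coefZ rmorphD rmorphM scalerDl scalerA.
Qed.

Lemma orbit_eval0 : orbit_eval 0 = 0.
Proof. by rewrite /orbit_eval size_poly0 big_ord0. Qed.

Lemma orbit_evalZ (a : R) f : orbit_eval (a *: f) = a%:C *: orbit_eval f.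
Proof. by rewrite -[a *: f]addr0 orbit_eval_linear orbit_eval0 addr0. Qed.

Lemma orbit_evalB f g : orbit_eval (f - g) = orbit_eval f - orbit_eval g.
Proof.
by rewrite -scaleN1r addrC orbit_eval_linear rmorphN rmorph1 scaleN1r addrC.
Qed.

Lemma orbit_eval_sum n (a : nat -> R) (p : nat -> {poly R}) :
  orbit_eval (\sum_(i < n) a i *: p i) = \sum_(i < n) (a i)%:C *: orbit_eval (p i).
Proof.
elim: n => [|n IH]; first by rewrite !big_ord0 orbit_eval0.
by rewrite !big_ord_recr/= addrC orbit_eval_linear IH addrC.
Qed.

Lemma orbit_evalXn m : orbit_eval 'X^m = op_pow T m (ebasis 0).
Proof.
rewrite /orbit_eval size_polyXn big_ord_recr/= coefXn eqxx scale1r.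
by rewrite big1 ?add0r// => i _; rewrite coefXn ltn_eqF// scale0r.
Qed.

(** Multiplication by ['X] corresponds to [T]; linearity of [T] applies because
    every [T^j e_0] lies in its domain. *)
Lemma orbit_evalXM f : orbit_eval ('X * f) = T (orbit_eval f).
Proof.
have [sT _ _] := triT.
have domT i : op_pow T i (ebasis 0) \in dom T by have [_ /sT] := op_pow_span i.
rewrite (@orbit_eval_widen (size f).+1); last first.
  by rewrite (leq_trans (size_polyMleq _ _))// size_polyX.
rewrite big_ord_recl coefXM/= scale0r add0r.
rewrite /orbit_eval.
have [_ ->] := @opfun_sum T (size f) (fun j => (f`_j)%:C) _ domT.
by apply: eq_bigr => i _; rewrite coefXM.
Qed.

Lemma orbit_eval_recurrence_poly n :
  orbit_eval (recurrence_poly d (fun n => l n.-1 * u n.-1) n) =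
  (\prod_(0 <= i < n) l i)%:C *: ebasis n.
Proof.
have [sT T0 Tn] := triT.
pose p := recurrence_poly d (fun n => l n.-1 * u n.-1).
pose L n := \prod_(0 <= i < n) l i.
have LS k : L k.+1 = L k * l k by rewrite /L big_nat_recr.
have TZ (a : R[i]) k : T (a *: ebasis k) = a *: T (ebasis k).
  have [d0 _] := dom_submod_closed T.
  by rewrite -[a *: _]addr0 opfun_linear// ?sT ?ebasis_span// opfun0 addr0.
(* The recurrence has depth two, so two consecutive indices are carried. *)
suff [] : orbit_eval (p n) = (L n)%:C *: ebasis n /\
          orbit_eval (p n.+1) = (L n.+1)%:C *: ebasis n.+1 by [].
have e1 : orbit_eval 1 = ebasis 0 by exact: (orbit_evalXn 0).
elim: n => [|n [IH0 IH1]].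
  split; first by rewrite e1 /L big_geq// scale1r.
  rewrite -[p 1]/('X - (d 0)%:P) -[X in X - _]mulr1 -alg_polyC.
  rewrite orbit_evalB orbit_evalXM orbit_evalZ e1 T0.
  by rewrite addrAC subrr add0r /L big_nat1.
split=> //.
rewrite -[p n.+2]/(('X - (d n.+1)%:P) * p n.+1 - (l n * u n) *: p n).
rewrite mulrBl mul_polyC !orbit_evalB !orbit_evalZ orbit_evalXM IH0 IH1.
rewrite TZ Tn//= !scalerDr !scalerA -!rmorphM/= (LS n.+1) LS.
(* The term u_n e_n of T e_(n+1) cancels against lambda_(n+1) p_n, and the
   term d_(n+1) e_(n+1) against b_(n+1) p_(n+1). *)
rewrite (_ : L n * l n * u n = l n * u n * L n); last by rewrite -mulrA mulrC.
by rewrite [L n * l n * d _]mulrC -addrA -opprD [X in _ - X]addrC addrAC subrr add0r.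
Qed.

End orbit.

Theorem theorem2p8 (R : realType) (T : linear_operator R) (l d u : nat -> R) :
  tridiagonal T l d u ->
  forall m k : nat,
  let p := recurrence_poly d (fun n => l n.-1 * u n.-1) in
  let mu := (inverse_poly p m)`_k in
  ebasis 0 \in dom (op_pow T m) /\
  inner (ebasis k) (op_pow T m (ebasis 0)) = ((\prod_(0 <= i < k) l i) * mu)%:C.
Proof.
move=> triT m k p mu; split; first by have [] := op_pow_span triT m.
have [sq XmE] := inverse_polyP m (recurrence_poly_monic d (fun n => l n.-1 * u n.-1)).
rewrite inner_ebasis -orbit_evalXn XmE.
rewrite (@orbit_eval_sum _ _ m.+1 (fun i => (inverse_poly p m)`_i) p).
have pE i := orbit_eval_recurrence_poly triT i; rewrite -/p in pE.
under [X in ell2_val X]eq_bigr do rewrite pE scalerA -rmorphM/= mulrC.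
rewrite (ell2_coord_sum m.+1
  (fun i => ((\prod_(0 <= j < i) l j) * (inverse_poly p m)`_i)%:C)).
case: ltnP => // mk.
(* Beyond the range of the sum the coefficient of the inverse polynomial is 0. *)
by rewrite /mu nth_default ?mulr0// (leq_trans sq).
Qed.
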